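(* Let $\lambda>0$ and consider the twisted $D_2Q_4$ scheme relative to $\tilde u=V=(V^x,V^y)\in\mathbb{R}^2$, with equilibrium moments $m^{eq}(V)=\rho(1,0,0,0)$ and relaxation parameters $s=(0,s_q,s_q,s_{xy})\in\mathbb{R}^4$. The matrix $J(V)$ has a pre-structure of stability if and only if $|V|_\infty<\lambda$. Moreover, if $0\le s_q,s_{xy}\le2$, then $J(V)$ has a structure of stability. The collision matrix $R(V)$ is then stable for $\|\cdot\|_P$ and the scheme is stable in the norm $\|\cdot\|_{P,\mathcal{L}}$, where $P$ is a matrix realizing the structure of stability.
   Context: $|V|_\infty=\max(|V^x|,|V^y|)$. Twisted $D_2Q_4$ scheme. Let $\Delta x,\Delta t>0$, $\lambda=\Delta x/\Delta t$, and let $\mathcal{L}$ be the lattice $\Delta x\,\mathbb{Z}^2$ or a finite periodic quotient of it. Velocities: $v_0=(\lambda,\lambda)$, $v_1=(-\lambda,\lambda)$, $v_2=(-\lambda,-\lambda)$, $v_3=(\lambda,-\lambda)$. Moment polynomials: $P_0=1$, $P_1=X$, $P_2=Y$, $P_3=XY$. For $\tilde u\in\mathbb{R}^2$, $M(\tilde u)$ is the invertible matrix $M(\tilde u)_{kj}=P_k(v_j-\tilde u)$. For $f=(f_0,\dots,f_3)$ put $\rho=\sum_jf_j$, $m=M(\tilde u)f$. One time step is: relaxation at each node $m_k^*=m_k+s_k(m_k^{eq}-m_k)$, with $m^{eq}$ a given linear function of $\rho$; $f^*=M(\tilde u)^{-1}m^*$; transport $f_j(x,t+\Delta t)=f_j^*(x-v_j\Delta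 t,t)$. Let $B$ be the matrix with $f^{eq}:=M(\tilde u)^{-1}m^{eq}=Bf$, $D=\mathrm{diag}(s)$, $J(\tilde u)=M(\tilde u)^{-1}DM(\tilde u)(B-I)$, and $R(\tilde u)=I+J(\tilde u)$ the collision matrix, so $f^*=R(\tilde u)f$; the scheme reads $f(\cdot,t+\Delta t)=T\,R(\tilde u)f(\cdot,t)$ with $T$ the transport operator. A matrix $N\in M_q(\mathbb{R})$ has a pre-structure of stability if there exist an invertible $P\in M_q(\mathbb{R})$ and vectors $a,p\in\mathbb{R}^q$ with $PNP^{-1}=-\mathrm{diag}(a)$ and ${}^tPP=\mathrm{diag}(p)$; it is a structure of stability if moreover $a_k\in[0,2]$ for all $k$. For invertible $P$ and $y\in\mathbb{R}^q$, $|y|_P=|Py|_2$ (Euclidean norm); $\|R\|_P=\sup_{|y|_P=1}|Ry|_P$; for $g:\mathcal{L}\to\mathbb{R}^q$, $\|g\|_{P,\mathcal{L}}=(\sum_{x\in\mathcal{L}}|g(x)|_P^2)^{1/2}$. An operator (the collision matrix, resp. the amplification operator $TR(\tilde u)$ of the scheme) is stable in a norm if its operator norm is at most $1$.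
   Formalization: The ''if and only if'' is stated for (s_q,s_xy)≠(0,0), since for s_q=s_xy=0 one has J(V)=0, which has a pre-structure of stability for every V; the ''Moreover'' part is stated under |V|_∞<λ. *)

(* Defs.v *)
From HB Require Import structures.
From mathcomp Require Import all_boot all_order all_algebra.
From mathcomp Require Import all_classical all_reals all_analysis.

Set Implicit Arguments.
Unset Strict Implicit.
Unset Printing Implicit Defensive.

Import Order.TTheory GRing.Theory Num.Theory.

Local Open Scope classical_set_scope.
Local Open Scope ring_scope.

Section Vectors.
Variable R : realType.

Definition vec2 (a b : R) : 'rV[R]_2 := \row_(i < 2) [:: a; b]`_i.
Definition vec4 (a b c d : R) : 'rV[R]_4 := \row_(i < 4) [:: a; b; c; d]`_i.

Definition maxnorm2 (V : 'rV[R]_2) : R := Num.max `|V 0 0| `|V 0 1|.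

End Vectors.

Section Scheme.
Variable R : realType.
Implicit Types (lambda dx dt : R) (u : 'rV[R]_2) (s : 'rV[R]_4).
Implicit Types (e : 'cV[R]_4).

Definition velocity lambda (j : 'I_4) : 'rV[R]_2 :=
  [:: vec2 lambda lambda; vec2 (- lambda) lambda;
      vec2 (- lambda) (- lambda); vec2 lambda (- lambda)]`_j.

(* 1, X, Y, XY as functions of (X, Y). *)
Definition moment_poly (k : 'I_4) (z : 'rV[R]_2) : R :=
  [:: 1; z 0 0; z 0 1; z 0 0 * z 0 1]`_k.

Definition moment_mx lambda u : 'M[R]_4 :=
  \matrix_(k < 4, j < 4) moment_poly k (velocity lambda j - u).

(* The equilibrium moments, a linear function of rho, are rho *: e; since     *)
(* rho = (const_mx 1 : 'rV_4) *m f, f^eq = M(u)^-1 m^eq is the product of the *)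
(* matrix below by f.                                                         *)
Definition equilibrium_mx lambda u e : 'M[R]_4 :=
  invmx (moment_mx lambda u) *m (e *m (const_mx 1 : 'rV[R]_4)).

Definition J_mx lambda u e s : 'M[R]_4 :=
  invmx (moment_mx lambda u) *m diag_mx s *m moment_mx lambda u
    *m (equilibrium_mx lambda u e - 1%:M).

Definition collision_mx lambda u e s : 'M[R]_4 := 1%:M + J_mx lambda u e s.

Definition grid dx : set 'rV[R]_2 :=
  [set z | exists a b : int, z = vec2 (dx * a%:~R) (dx * b%:~R)].

(* L is the grid dx Z^2 or a finite quotient of it by a subgroup of periods,  *)
(* up to isomorphism: pr, of which only the restriction to the grid matters,  *)
(* is a surjective group morphism from the grid to L.                         *)
Definition is_lattice dx (L : zmodType) (pr : 'rV[R]_2 -> L) : Prop :=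
  [/\ {in grid dx &, {morph pr : y z / y + z}},
      pr @` grid dx = [set: L]
    & set_inj (grid dx) pr \/ finite_set [set: L]].

Definition transport lambda dt (L : zmodType) (pr : 'rV[R]_2 -> L)
    (g : L -> 'cV[R]_4) : L -> 'cV[R]_4 :=
  fun x => \col_(j < 4) g (x - pr (dt *: velocity lambda j)) j 0.

Definition amplification lambda dt u e s (L : zmodType) (pr : 'rV[R]_2 -> L)
    (g : L -> 'cV[R]_4) : L -> 'cV[R]_4 :=
  transport lambda dt pr (fun x => collision_mx lambda u e s *m g x).

End Scheme.

Section StabilityStructure.
Variables (R : realType) (q : nat).
Implicit Types (N P : 'M[R]_q) (a p : 'rV[R]_q).

Definition pre_structure_for N P a p : Prop :=
  [/\ P \in unitmx, P *m N *m invmx P = - diag_mx a & P^T *m P = diag_mx p].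

Definition has_pre_structure_of_stability N : Prop :=
  exists P a p, pre_structure_for N P a p.

Definition realizes_structure_of_stability N P : Prop :=
  exists a p, pre_structure_for N P a p /\ forall k, 0 <= a 0 k <= 2.

Definition has_structure_of_stability N : Prop :=
  exists P, realizes_structure_of_stability N P.

End StabilityStructure.

Section Norms.
Variable R : realType.
Local Open Scope ereal_scope.

Definition norm2 (q : nat) (y : 'cV[R]_q) : R :=
  Num.sqrt (\sum_(i < q) y i 0 ^+ 2)%R.

Definition Pnorm (q : nat) (P : 'M[R]_q) (y : 'cV[R]_q) : R := norm2 (P *m y).

(* On an infinite lattice, +oo when g is not square-summable. *)
Definition lattice_norm (q : nat) (P : 'M[R]_q) (L : zmodType)
    (g : L -> 'cV[R]_q) : \bar R :=
  sqrte (\esum_(x in [set: L]) ((Pnorm P (g x)) ^+ 2)%:E).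

Definition operator_norm (W : Type) (nrm : W -> \bar R) (A : W -> W) : \bar R :=
  ereal_sup [set nrm (A y) | y in [set y | nrm y = 1]].

Definition stable (W : Type) (nrm : W -> \bar R) (A : W -> W) : Prop :=
  operator_norm nrm A <= 1.

End Norms.

(* Main.v *)
Require Import Defs.
From mathcomp Require Import all_boot all_order all_algebra.
From mathcomp Require Import all_classical all_reals all_analysis.
From mathcomp Require Import ring lra.
Import Order.TTheory GRing.Theory Num.Theory.
Local Open Scope classical_set_scope.
Local Open Scope ring_scope.

Set Implicit Arguments.
Unset Strict Implicit.

(** Since [s 0 0 = 0], [diag_mx s] annihilates the equilibrium moments
    (1,0,0,0), so [J] is conjugate to [- diag_mx s] through the moment matrix
    [M] ([moment_mx_J]): the rows of [M], which are the functions
    1, X - V^x, Y - V^y and their product (X - V^x)(Y - V^y) on the four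
    velocities, are left eigenvectors of [J].  A pre-structure of stability
    amounts to positive weights w_j = 1 / p_j on the velocities for which left
    eigenvectors with distinct eigenvalues are orthogonal
    ([left_eigen_orthogonal], with a converse in
    [weighted_orthogonal_pre_structure]).

    Existence.  The weights of the product law on {-lambda, lambda}^2 with
    mean V make the four rows of [M] orthogonal, by independence of the two
    coordinates, and they are positive exactly when V lies inside the square.

    Necessity.  If sq <> 0, orthogonality of 1 with X - V^x and Y - V^y says
    that V is the mean of the velocities for positive weights, hence is interior
    to their convex hull, the square.  If sq = 0 and sxy <> 0, the function
    w (X - V^x)(Y - V^y) is orthogonal to 1, X, Y, so it is a multiple of XY;
    comparing its values at neighbouring velocities bounds V^x and V^y
    ([split_balance_norm_lt]).

    Stability.  The matrix [P] turns the collision into the diagonal matrix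
    1 - a with |1 - a_k| <= 1.  As the columns of [P] are orthogonal, the
    squared norm of [P y] is a weighted sum of the squares of the components of
    [y], each of which transport merely translates on the lattice
    ([esum_shift_Pnorm]). *)

(** * Structures of stability and weighted inner products *)

(** Each entry of [p] is the squared norm of a column of [P]. *)
Lemma diag_gram_gt0 (R : realType) (q : nat) (P : 'M[R]_q) (p : 'rV[R]_q) :
  P \in unitmx -> P^T *m P = diag_mx p -> forall j, 0 < p 0 j.
Proof.
move=> Pu Pp j.
have pj : p 0 j = \sum_i P i j ^+ 2.
  have := congr1 (fun A : 'M[R]_q => A j j) Pp.
  rewrite !mxE eqxx mulr1n => <-.
  by apply: eq_bigr => i _; rewrite !mxE expr2.
rewrite lt0r pj sumr_ge0 ?andbT; last by move=> i _; exact: sqr_ge0.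
apply/eqP => /psumr_eq0P Pj0.
have Pdj : P *m delta_mx j (0 : 'I_1) = 0.
  apply/matrixP => i k; rewrite -colE !mxE.
  apply/eqP; rewrite -sqrf_eq0; apply/eqP/Pj0 => // l _.
  exact: sqr_ge0.
have /matrixP/(_ j 0) := congr1 (mulmx (invmx P)) Pdj.
rewrite mulKmx // mulmx0 !mxE !eqxx /= => /eqP.
by rewrite oner_eq0.
Qed.

(** The hypotheses say that [N *m W] is symmetric for
    [W := diag_mx p^-1 = invmx P *m (invmx P)^T]; this is the usual
    orthogonality of the eigenvectors of a self-adjoint operator. *)
Lemma left_eigen_orthogonal (R : realType) (q : nat) (N P : 'M[R]_q)
    (a p : 'rV[R]_q) (m1 m2 : R) (l1 l2 : 'rV[R]_q) :
  pre_structure_for N P a p ->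
  l1 *m N = m1 *: l1 -> l2 *m N = m2 *: l2 -> m1 != m2 ->
  \sum_j (p 0 j)^-1 * (l1 0 j * l2 0 j) = 0.
Proof.
move=> [Pu PN Pp] l1N l2N m12.
have p_gt0 := diag_gram_gt0 Pu Pp.
pose W : 'M[R]_q := diag_mx (\row_j (p 0 j)^-1).
have WE : W = invmx P *m (invmx P)^T.
  have pW : diag_mx p *m W = 1%:M.
    apply/matrixP => i j; rewrite mul_diag_mx !mxE.
    case: eqVneq => [->|_]; last by rewrite mulr0n mulr0.
    by rewrite mulr1n mulfV // gt_eqF.
  have PtPu : P^T *m P \in unitmx by rewrite unitmx_mul unitmx_tr Pu.
  apply: (can_inj (mulKmx PtPu)).
  rewrite {1}Pp pW mulmxA mulmxK // trmx_inv mulmxV //.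
  by rewrite unitmx_tr.
have NW : (N *m W)^T = N *m W.
  have -> : N *m W = - (invmx P *m diag_mx a *m (invmx P)^T).
    have -> : N = invmx P *m (P *m N *m invmx P) *m P.
      by rewrite !mulmxA mulVmx // mul1mx mulmxKV.
    by rewrite PN WE mulmxN !mulNmx mulmxA mulmxK.
  by rewrite linearN /= !trmx_mul trmxK tr_diag_mx mulmxA.
have form (l l' : 'rV[R]_q) :
    (l *m W *m l'^T) 0 0 = \sum_j (p 0 j)^-1 * (l 0 j * l' 0 j).
  rewrite mxE; apply: eq_bigr => j _.
  by rewrite mul_mx_diag !mxE; ring.
rewrite -form.
have H1 : l1 *m (N *m W) *m l2^T = m1 *: (l1 *m W *m l2^T).
  by rewrite mulmxA l1N -!scalemxAl.
have H2 : l1 *m (N *m W) *m l2^T = m2 *: (l1 *m W *m l2^T).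
  rewrite -NW trmx_mul -!mulmxA -trmx_mul l2N linearZ /= -!scalemxAr.
  by rewrite tr_diag_mx.
have /matrixP/(_ 0 0) : (m1 - m2) *: (l1 *m W *m l2^T) = 0.
  by rewrite scalerBl -H1 -H2 subrr.
rewrite mxE [RHS]mxE => /eqP; rewrite mulf_eq0 subr_eq0 (negbTE m12) /=.
by move/eqP.
Qed.

(** Normalising the rows of [M] for the inner product of weights [w] gives
    a [P] with [P *m diag_mx w *m P^T = 1], that is, [P^T *m P] is the inverse
    of [diag_mx w]. *)
Lemma weighted_orthogonal_pre_structure (R : realType) (q : nat)
    (N M : 'M[R]_q) (a w d : 'rV[R]_q) :
  (forall j, 0 < w 0 j) -> (forall i, 0 < d 0 i) ->
  M *m N = - (diag_mx a *m M) -> M *m diag_mx w *m M^T = diag_mx d ->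
  exists P p, pre_structure_for N P a p.
Proof.
move=> w_gt0 d_gt0 MN MwM.
pose c : 'rV[R]_q := \row_i (Num.sqrt (d 0 i))^-1.
pose P := diag_mx c *m M.
pose p : 'rV[R]_q := \row_j (w 0 j)^-1.
have PwP : P *m diag_mx w *m P^T = 1%:M.
  rewrite /P trmx_mul tr_diag_mx.
  rewrite -(mulmxA _ M) -!(mulmxA (diag_mx c)).
  rewrite (mulmxA (M *m diag_mx w)) MwM.
  apply/matrixP => i j; rewrite mul_diag_mx mul_mx_diag !mxE.
  case: eqVneq => [->|_]; last by rewrite !mulr0n mul0r mulr0.
  rewrite !mulr1n -{2}(sqr_sqrtr (ltW (d_gt0 j))).
  have : Num.sqrt (d 0 j) != 0 by rewrite gt_eqF // sqrtr_gt0.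
  by move=> ?; field.
have Pu : P \in unitmx by case: (mulmx1_unit (etrans (mulmxA _ _ _) PwP)).
exists P, p; split=> //.
  suff PN : P *m N = - diag_mx a *m P by rewrite PN mulmxK.
  rewrite /P -mulmxA MN mulmxN mulNmx !mulmxA; congr (- (_ *m _)).
  exact: diag_mxC.
have wPP : diag_mx w *m (P^T *m P) = 1%:M.
  by rewrite mulmxA; apply: mulmx1C; rewrite mulmxA.
have pw : diag_mx p *m diag_mx w = 1%:M.
  apply/matrixP => i j; rewrite mul_diag_mx !mxE.
  case: eqVneq => [->|_]; last by rewrite mulr0n mulr0.
  by rewrite mulr1n mulVf // gt_eqF.
by rewrite -[LHS]mul1mx -pw -mulmxA wPP mulmx1.
Qed.

(** * Contraction by the collision, invariance under transport *)

Lemma norm2_sqr (R : realType) (q : nat) (y : 'cV[R]_q) :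
  norm2 y ^+ 2 = \sum_i y i 0 ^+ 2.
Proof. by rewrite sqr_sqrtr // sumr_ge0 // => i _; exact: sqr_ge0. Qed.

Lemma Pnorm_sqr (R : realType) (q : nat) (P : 'M[R]_q) (p : 'rV[R]_q)
    (y : 'cV[R]_q) :
  P^T *m P = diag_mx p -> Pnorm P y ^+ 2 = \sum_j p 0 j * y j 0 ^+ 2.
Proof.
move=> Pp; rewrite norm2_sqr.
have -> : \sum_i (P *m y) i 0 ^+ 2 = ((P *m y)^T *m (P *m y)) 0 0.
  by rewrite [RHS]mxE; apply: eq_bigr => i _; rewrite [_^T 0 i]mxE expr2.
rewrite trmx_mul -mulmxA (mulmxA P^T) Pp mxE; apply: eq_bigr => j _.
by rewrite mul_diag_mx !mxE; ring.
Qed.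

Lemma structure_contracting (R : realType) (q : nat) (N P : 'M[R]_q)
    (y : 'cV[R]_q) :
  realizes_structure_of_stability N P ->
  Pnorm P ((1%:M + N) *m y) <= Pnorm P y.
Proof.
move=> [a] [p] [[Pu PN _] a02]; rewrite /Pnorm /norm2.
have -> : P *m ((1%:M + N) *m y) = P *m y - diag_mx a *m (P *m y).
  have -> : diag_mx a = - (P *m N *m invmx P) by rewrite PN opprK.
  rewrite mulNmx opprK mulmxA -(mulmxA _ (invmx P)) mulKmx //.
  by rewrite mulmxDr mulmx1 mulmxDl.
apply: ler_wsqrtr; apply: ler_sum => i _.
rewrite mul_diag_mx !mxE.
set z := \sum_(j < q) _; move: z => z.
have /andP[a0 a2] := a02 i.
have -> : (z - a 0 i * z) ^+ 2 = (1 - a 0 i) ^+ 2 * z ^+ 2 by ring.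
apply: ler_piMl; first exact: sqr_ge0.
rewrite -[leRHS](expr1n _ 2) -real_normK ?num_real // lerXn2r ?nnegrE //.
by rewrite ler_norml; lra.
Qed.

(** Transport is an isometry: by [Pnorm_sqr] the norm is a sum over [j] of
    norms of scalar functions on [L], each invariant under its own
    translation. *)
Lemma esum_shift_Pnorm (R : realType) (q : nat) (P : 'M[R]_q) (p : 'rV[R]_q)
    (L : zmodType) (c : 'I_q -> L) (g : L -> 'cV[R]_q) :
  P \in unitmx -> P^T *m P = diag_mx p ->
  (\esum_(x in [set: L]) (Pnorm P (\col_j g (x - c j) j 0) ^+ 2)%:E =
   \esum_(x in [set: L]) (Pnorm P (g x) ^+ 2)%:E)%E.
Proof.
move=> Pu Pp; have p_gt0 := diag_gram_gt0 Pu Pp.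
have term_ge0 (y : R) j : (0 <= (p 0 j * y ^+ 2)%:E)%E.
  by rewrite lee_fin mulr_ge0 ?sqr_ge0 // ltW.
under eq_esum do rewrite (Pnorm_sqr _ Pp) -sumEFin.
under [RHS]eq_esum do rewrite (Pnorm_sqr _ Pp) -sumEFin.
rewrite !esum_sum //; apply: eq_bigr => j _.
rewrite [RHS](reindex_esum setT setT (fun x => x - c j)).
  by apply: eq_esum => x _; rewrite mxE.
split=> // [x y _ _ /addIr //|x _].
by exists (x + c j); rewrite ?addrK.
Qed.

Lemma stable_contracting (R : realType) (W : Type) (nrm : W -> \bar R)
    (A : W -> W) :
  (forall y, nrm (A y) <= nrm y)%E -> stable nrm A.
Proof.
by move=> nrmA; apply: ge_ereal_sup => _ [y /= <-] <-; exact: nrmA.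
Qed.

(** * Moments of the four velocities *)

Lemma velocity_xE (R : realType) (lambda : R) (j : 'I_4) :
  velocity lambda j 0 0 = [:: lambda; - lambda; - lambda; lambda]`_j.
Proof. by case: j => [[|[|[|[|//]]]] ?]; rewrite !mxE. Qed.

Lemma velocity_yE (R : realType) (lambda : R) (j : 'I_4) :
  velocity lambda j 0 1 = [:: lambda; lambda; - lambda; - lambda]`_j.
Proof. by case: j => [[|[|[|[|//]]]] ?]; rewrite !mxE. Qed.

Lemma moment_mxE (R : realType) (lambda : R) (u : 'rV[R]_2) (k j : 'I_4) :
  let x := velocity lambda j 0 0 - u 0 0 in
  let y := velocity lambda j 0 1 - u 0 1 in
  moment_mx lambda u k j = [:: 1; x; y; x * y]`_k.
Proof. by rewrite mxE /moment_poly !mxE. Qed.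

(** The law of mean [u] on the four velocities whose coordinates are
    independent, a signed measure when [u] is outside the square; it is the
    distribution [f^eq] of mass 1. *)
Definition product_weight {R : realType} (lambda : R) (u : 'rV[R]_2) :
    'rV[R]_4 :=
  \row_j ((lambda ^+ 2 + velocity lambda j 0 0 * u 0 0) *
          (lambda ^+ 2 + velocity lambda j 0 1 * u 0 1) / (4 * lambda ^+ 4)).

(** The inverse of [moment_mx]: a distribution [f] is
    1/4 of the sum of rho, m_X vx / lambda^2, m_Y vy / lambda^2 and
    m_XY vx vy / lambda^4, where the moments about 0 are
    m_X = m_1 + u^x rho, m_Y = m_2 + u^y rho and
    m_XY = m_3 + u^x m_2 + u^y m_1 + u^x u^y rho. *)
Definition moment_inv {R : realType} (lambda : R) (u : 'rV[R]_2) : 'M[R]_4 :=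
  \matrix_(j, k)
    [:: product_weight lambda u 0 j;
        velocity lambda j 0 0 * (lambda ^+ 2 + velocity lambda j 0 1 * u 0 1)
          / (4 * lambda ^+ 4);
        velocity lambda j 0 1 * (lambda ^+ 2 + velocity lambda j 0 0 * u 0 0)
          / (4 * lambda ^+ 4);
        velocity lambda j 0 0 * velocity lambda j 0 1 / (4 * lambda ^+ 4)]`_k.

Lemma moment_mx_unit (R : realType) (lambda : R) (u : 'rV[R]_2) :
  lambda != 0 -> moment_mx lambda u \in unitmx.
Proof.
move=> l0.
suff /mulmx1_unit[] : moment_mx lambda u *m moment_inv lambda u = 1%:M by [].
move: (moment_mx _ _) (moment_mxE lambda u) => M ME.
apply/matrixP => i k; rewrite mxE !big_ord_recl big_ord0 !mxE !ME.
rewrite !velocity_xE !velocity_yE.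
case: i => [[|[|[|[|//]]]] ?]; case: k => [[|[|[|[|//]]]] ?];
  rewrite /= ?mulr0n ?mulr1n; field; exact: l0.
Qed.

(** For independent coordinates of mean [u], the centred coordinates are
    uncorrelated with each other and with their product, and
    lambda^2 - u^2 is the variance of a coordinate with values +- lambda. *)
Lemma moment_orthogonal (R : realType) (lambda : R) (u : 'rV[R]_2) :
  lambda != 0 ->
  moment_mx lambda u *m diag_mx (product_weight lambda u)
    *m (moment_mx lambda u)^T
  = diag_mx (vec4 1 (lambda ^+ 2 - u 0 0 ^+ 2) (lambda ^+ 2 - u 0 1 ^+ 2)
      ((lambda ^+ 2 - u 0 0 ^+ 2) * (lambda ^+ 2 - u 0 1 ^+ 2))).
Proof.
move=> l0; rewrite mul_mx_diag.
move: (moment_mx _ _) (moment_mxE lambda u) => M ME.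
apply/matrixP => i k; rewrite mxE !big_ord_recl big_ord0 !mxE !ME.
rewrite !velocity_xE !velocity_yE.
case: i => [[|[|[|[|//]]]] ?]; case: k => [[|[|[|[|//]]]] ?];
  rewrite /= ?mulr0n ?mulr1n; field; exact: l0.
Qed.

Lemma moment_mx_J (R : realType) (lambda : R) (u : 'rV[R]_2) (s : 'rV[R]_4) :
  lambda != 0 -> s 0 0 = 0 ->
  moment_mx lambda u *m J_mx lambda u (vec4 1 0 0 0)^T s =
  - (diag_mx s *m moment_mx lambda u).
Proof.
move=> l0 s0; have Mu := moment_mx_unit u l0.
have se : diag_mx s *m (vec4 1 0 0 0)^T = 0 :> 'cV[R]_4.
  apply/matrixP => i j; rewrite mul_diag_mx !mxE.
  case: i => [[|[|[|[|//]]]] i4] /=; rewrite ?mulr0 // mulr1 -[RHS]s0.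
  by congr (s 0 _); exact: val_inj.
rewrite /J_mx /equilibrium_mx -!mulmxA mulKVmx // !mulmxBr mulmx1.
rewrite (mulmxA (moment_mx lambda u)) mulmxV // mul1mx mulmxA se mul0mx.
by rewrite sub0r.
Qed.

Lemma moment_row_eigen (R : realType) (lambda : R) (u : 'rV[R]_2)
    (s : 'rV[R]_4) (k : 'I_4) :
  lambda != 0 -> s 0 0 = 0 ->
  row k (moment_mx lambda u) *m J_mx lambda u (vec4 1 0 0 0)^T s =
  - s 0 k *: row k (moment_mx lambda u).
Proof.
move=> l0 s0; rewrite -row_mul moment_mx_J //.
rewrite mul_diag_mx; move: (moment_mx _ _) => M.
by apply/rowP => j; rewrite !mxE mulNr.
Qed.

(** * Necessity of the bound on the velocity *)

(** The equation says that [x] is the barycentre of lambda and - lambda with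
    weights [A] and [B]. *)
Lemma balance_norm_lt (R : realType) (lambda A B x : R) :
  0 < lambda -> 0 < A -> 0 < B ->
  A * (lambda - x) = B * (lambda + x) -> `|x| < lambda.
Proof.
move=> l0 A0 B0 AB; rewrite ltr_norml; apply/andP; split; rewrite ltNge.
  apply/negP => xl.
  have : 0 < A * (lambda - x) by apply: mulr_gt0 => //; lra.
  have : B * (lambda + x) <= 0 by apply: mulr_ge0_le0; lra.
  lra.
apply/negP => xl.
have : 0 < B * (lambda + x) by apply: mulr_gt0 => //; lra.
have : A * (lambda - x) <= 0 by apply: mulr_ge0_le0; lra.
lra.
Qed.

Lemma split_balance_norm_lt (R : realType) (lambda A B C D x y : R) :
  0 < lambda -> 0 < A -> 0 < B -> 0 < C -> 0 < D ->
  (lambda - y) * (A * (lambda - x)) = (lambda - y) * (B * (lambda + x)) ->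
  (lambda + y) * (C * (lambda - x)) = (lambda + y) * (D * (lambda + x)) ->
  `|x| < lambda.
Proof.
move=> l0 A0 B0 C0 D0 AB CD.
(* Since lambda > 0, lambda - y and lambda + y do not vanish together. *)
have [yl|/mulfI yl] := eqVneq (lambda - y) 0; last first.
  exact: balance_norm_lt l0 A0 B0 (yl _ _ AB).
have /mulfI yl' : lambda + y != 0 by apply: lt0r_neq0; lra.
exact: balance_norm_lt l0 C0 D0 (yl' _ _ CD).
Qed.

Lemma sum_ord4 (R : realType) (F : 'I_4 -> R) :
  \sum_j F j = F (inord 0) + F (inord 1) + F (inord 2) + F (inord 3).
Proof.
rewrite !big_ord_recl big_ord0 addr0 !addrA.
by congr (F _ + F _ + F _ + F _); apply: val_inj; rewrite /= inordK.
Qed.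

Lemma pre_structure_norm_lt (R : realType) (lambda sq sxy : R)
    (V : 'rV[R]_2) :
  0 < lambda -> ~ (sq = 0 /\ sxy = 0) ->
  has_pre_structure_of_stability
    (J_mx lambda V (vec4 1 0 0 0)^T (vec4 0 sq sq sxy)) ->
  maxnorm2 V < lambda.
Proof.
move=> l0 snz [P [a [p HP]]].
have l_neq0 := lt0r_neq0 l0.
set s := vec4 0 sq sq sxy in HP.
have s00 : s 0 0 = 0 by rewrite mxE.
have [w [w_gt0 orth]] : exists w : 'I_4 -> R, (forall j, 0 < w j) /\
    forall k k' : 'I_4, s 0 k != s 0 k' ->
    \sum_j w j * (moment_mx lambda V k j * moment_mx lambda V k' j) = 0.
  exists (fun j => (p 0 j)^-1); split=> [j|k k' skk'].
    by have [Pu _ Pp] := HP; rewrite invr_gt0 (diag_gram_gt0 Pu Pp).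
  have mkk' : - s 0 k != - s 0 k' by rewrite eqr_opp.
  have := left_eigen_orthogonal HP
    (moment_row_eigen V k l_neq0 s00)
    (moment_row_eigen V k' l_neq0 s00) mkk'.
  by move=> {2}<-; apply: eq_bigr => j _; rewrite ![row _ _ _ _]mxE.
rewrite gt_max; apply/andP.
pose i1 : 'I_4 := inord 1; pose i2 : 'I_4 := inord 2; pose i3 : 'I_4 := inord 3.
have sE : (s 0 i1 = sq) * (s 0 i2 = sq) * (s 0 i3 = sxy).
  by rewrite !mxE !inordK.
have momentE := (moment_mxE, velocity_xE, velocity_yE).
have [sq0|sq_neq0] := eqVneq sq 0; last first.
  have sq01 : s 0 0 != s 0 i1 by rewrite s00 sE eq_sym.
  have sq02 : s 0 0 != s 0 i2 by rewrite s00 sE eq_sym.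
  have := orth _ _ sq01; have := orth _ _ sq02.
  rewrite !sum_ord4 !momentE !inordK //=.
  move: (w_gt0 (inord 0)) (w_gt0 i1) (w_gt0 i2) (w_gt0 i3).
  move: (w (inord 0)) (w i1) (w i2) (w i3) => w0 w1 w2 w3.
  move=> w0_gt0 w1_gt0 w2_gt0 w3_gt0 Ey Ex.
  split.
    apply: (@balance_norm_lt _ _ (w0 + w3) (w1 + w2));
      rewrite ?addr_gt0 //; lra.
  apply: (@balance_norm_lt _ _ (w0 + w1) (w2 + w3));
    rewrite ?addr_gt0 //; lra.
have sxy_neq0 : sxy != 0 by apply/eqP => sxy0; case: snz.
have s30 : s 0 i3 != s 0 0 by rewrite s00 sE.
have s31 : s 0 i3 != s 0 i1 by rewrite !sE sq0.
have s32 : s 0 i3 != s 0 i2 by rewrite !sE sq0.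
have := orth _ _ s30; have := orth _ _ s31; have := orth _ _ s32.
rewrite !sum_ord4 !momentE !inordK //=.
move: (w_gt0 (inord 0)) (w_gt0 i1) (w_gt0 i2) (w_gt0 i3).
move: (w (inord 0)) (w i1) (w i2) (w i3) => w0 w1 w2 w3.
move=> w0_gt0 w1_gt0 w2_gt0 w3_gt0 Ey Ex E1.
move: (V 0 0) (V 0 1) E1 Ex Ey => x y E1 Ex Ey.
(* k0, - k1, k2, - k3 are the values of w (X - x)(Y - y) at the four
   velocities; its orthogonality to 1, X and Y makes the k's equal. *)
pose k0 := w0 * ((lambda - x) * (lambda - y)).
pose k1 := w1 * ((lambda + x) * (lambda - y)).
pose k2 := w2 * ((lambda + x) * (lambda + y)).
pose k3 := w3 * ((lambda - x) * (lambda + y)).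
(* Adding x times E1 replaces X - x by X in Ex. *)
have {}Ex : k0 + k1 - k2 - k3 = 0.
  apply: (mulfI l_neq0); have := congr1 ( *%R x) E1.
  rewrite /k0 /k1 /k2 /k3; lra.
have {}Ey : k0 - k1 - k2 + k3 = 0.
  apply: (mulfI l_neq0); have := congr1 ( *%R y) E1.
  rewrite /k0 /k1 /k2 /k3; lra.
have {}E1 : k0 - k1 + k2 - k3 = 0 by rewrite /k0 /k1 /k2 /k3; lra.
split.
  apply: (@split_balance_norm_lt _ lambda w0 w1 w3 w2 x y) => //.
    have : k0 = k1 by lra.
    by rewrite /k0 /k1; lra.
  have : k3 = k2 by lra.
  by rewrite /k2 /k3; lra.
apply: (@split_balance_norm_lt _ lambda w0 w3 w1 w2 y x) => //.
  have : k0 = k3 by lra.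
  by rewrite /k0 /k3; lra.
have : k1 = k2 by lra.
by rewrite /k1 /k2; lra.
Qed.

(** * Sufficiency of the bound *)

Lemma norm_lt_pre_structure (R : realType) (lambda : R) (s : 'rV[R]_4)
    (V : 'rV[R]_2) :
  0 < lambda -> s 0 0 = 0 -> maxnorm2 V < lambda ->
  exists P p,
    pre_structure_for (J_mx lambda V (vec4 1 0 0 0)^T s) P s p.
Proof.
move=> l0 s00; rewrite gt_max => /andP[xl yl].
have l_neq0 := lt0r_neq0 l0.
apply: weighted_orthogonal_pre_structure
  (moment_mx_J _ l_neq0 s00) (moment_orthogonal _ l_neq0).
  have factor_gt0 (v z : R) : `|v| = lambda -> `|z| < lambda ->
      0 < lambda ^+ 2 + v * z.
    move=> vl zl; have := ler_norm (- (v * z)); rewrite normrN normrM vl.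
    have : lambda * `|z| < lambda ^+ 2 by rewrite expr2 ltr_pM2l.
    lra.
  have velocity_norm j : (`|velocity lambda j 0 0| = lambda) *
                         (`|velocity lambda j 0 1| = lambda).
    rewrite velocity_xE velocity_yE.
    by case: j => [[|[|[|[|//]]]] ?] /=; rewrite ?normrN gtr0_norm.
  move=> j; rewrite mxE; apply: divr_gt0.
    by apply: mulr_gt0; rewrite factor_gt0 ?velocity_norm.
  by rewrite pmulr_rgt0 ?exprn_gt0.
have sqr_lt (z : R) : `|z| < lambda -> 0 < lambda ^+ 2 - z ^+ 2.
  by move=> zl; rewrite subr_gt0 -real_normK ?num_real // ltrXn2r // nnegrE ltW.
by case=> [[|[|[|[|//]]]] ?]; rewrite mxE /= ?mulr_gt0 ?sqr_lt.
Qed.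

(** * The characterization and its stability consequences *)

Unset Implicit Arguments.
Set Strict Implicit.

Theorem proposition4p4 (R : realType) (lambda dx dt : R)
    (dx_gt0 : 0 < dx) (dt_gt0 : 0 < dt) (lambdaE : lambda = dx / dt)
    (lambda_gt0 : 0 < lambda) (V : 'rV[R]_2) (sq sxy : R) :
  let e : 'cV[R]_4 := (vec4 1 0 0 0)^T in
  let s : 'rV[R]_4 := vec4 0 sq sq sxy in
  let J := J_mx lambda V e s in
  (~ (sq = 0 /\ sxy = 0) ->
    (has_pre_structure_of_stability J <-> maxnorm2 V < lambda)) /\
  (maxnorm2 V < lambda -> 0 <= sq <= 2 -> 0 <= sxy <= 2 ->
    has_structure_of_stability J /\
    forall P : 'M[R]_4, realizes_structure_of_stability J P ->
      stable (fun y : 'cV[R]_4 => (Pnorm P y)%:E)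
             (fun y => collision_mx lambda V e s *m y) /\
      forall (L : zmodType) (pr : 'rV[R]_2 -> L), is_lattice dx pr ->
        stable (fun g : L -> 'cV[R]_4 => lattice_norm P g)
               (amplification lambda dt V e s pr)).
Proof.
move=> e s J.
have s00 : s 0 0 = 0 by rewrite mxE.
split=> [snz|Vl sq02 sxy02].
  split; first exact: pre_structure_norm_lt.
  by case/(norm_lt_pre_structure lambda_gt0 s00) => P [p ?]; exists P, s, p.
have s02 k : 0 <= s 0 k <= 2.
  by rewrite mxE; case: k => [[|[|[|[|//]]]] ?] //=; rewrite lexx ler0n.
split.
  by have [P [p ?]] := norm_lt_pre_structure lambda_gt0 s00 Vl; exists P, s, p.
move=> P HP; have contr y := structure_contracting y HP.
split=> [|L pr _].
  by apply: stable_contracting => y; rewrite lee_fin; exact: contr.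
apply: stable_contracting => g.
have [a [p [[Pu _ Pp] _]]] := HP.
have ge0 (h : L -> 'cV[R]_4) :
    (0 <= \esum_(x in [set: L]) (Pnorm P (h x) ^+ 2)%:E)%E.
  by apply: esum_ge0 => x _; rewrite lee_fin sqr_ge0.
rewrite /lattice_norm lee_sqrt //.
have := esum_shift_Pnorm (fun j => pr (dt *: velocity lambda j))
  (fun x => collision_mx lambda V e s *m g x) Pu Pp.
rewrite /amplification /transport => ->.
by apply: le_esum => x _; rewrite lee_fin lerXn2r ?nnegrE ?sqrtr_ge0.
Qed.
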